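(* Let $\mathbb K$ be an algebraically closed field. Let $f\colon\mathbb N\to\mathbb N$ be submultiplicative and increasing, that is, $f(m+n)\le f(m)f(n)$ for all $m,n\in\mathbb N$ and $f(n+1)\ge f(n)$ for all $n\in\mathbb N$. Then there exists a finitely generated associative $\mathbb K$-algebra $B$, graded and generated in degree one, such that for all $n\in\mathbb N$ \[f(2^n)\le \dim B(2^n)\le 2^{2n+3}f(2^{n+1}),\] where $B(k)$ denotes the homogeneous component of degree $k$ of $B$. Furthermore, $B$ may be chosen to be a monomial algebra.
   Context: $\mathbb N=\{0,1,2,\dots\}$. A monomial algebra is a quotient of a free associative algebra $\mathbb K\langle x_1,\dots,x_r\rangle$ by a two-sided ideal generated by a set of monomials (words) in the $x_i$; it is graded with the generators $x_i$ in degree one. *)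

(* Defs.v *)
From mathcomp Require Import all_boot all_algebra.
From mathcomp Require Import finmap.
From mathcomp.multinomials Require Import monalg.

Set Implicit Arguments.
Unset Strict Implicit.
Unset Printing Implicit Defensive.

Import GRing.Theory.
Local Open Scope ring_scope.

Section Algebra.
Variables (K : fieldType) (B : algType K).

(* B need not be finite-dimensional, so the dimension theory of vectType is not
   available for its subspaces. *)
Definition has_dim (V : {pred B}) (d : nat) : Prop :=
  exists e : 'I_d -> B,
    (forall v, v \in V <-> exists c : 'I_d -> K, v = \sum_i c i *: e i) /\
    (forall c : 'I_d -> K, \sum_i c i *: e i = 0 -> forall i, c i = 0).

(* The smallest unital subalgebra containing S is B. *)
Definition generates (S : {pred B}) : Prop :=
  forall A : {pred B}, subalg_closed A -> {subset S <= A} -> forall x, x \in A.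

Definition finitely_generated : Prop :=
  exists s : seq B, generates [pred x in s].

Record graded (gr : nat -> {pred B}) : Prop := Graded {
  graded_submod : forall n, submod_closed (gr n);
  graded_one : 1 \in gr 0%N;
  graded_mul : forall m n x y,
    x \in gr m -> y \in gr n -> x * y \in gr (m + n)%N;
  graded_span : forall x, exists n (c : nat -> B),
    (forall i, c i \in gr i) /\ x = \sum_(i < n) c i;
  graded_direct : forall n (c : nat -> B),
    (forall i, c i \in gr i) -> \sum_(i < n) c i = 0 ->
    forall i, (i < n)%N -> c i = 0
}.

Definition generated_in_degree_one (gr : nat -> {pred B}) : Prop :=
  generates (gr 1%N).

End Algebra.

Section Monomial.
Variables (K : fieldType) (r : nat).
(* The free unital associative algebra K<x_1, ..., x_r>, as the algebra of the
   monoid of words in r letters. *)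
Local Notation F := {malg K[{fmonom 'I_r}]}.

Definition homogeneous (n : nat) (g : F) : Prop :=
  forall w : {fmonom 'I_r}, w \in msupp g -> fdeg w = n.

Definition two_sided_ideal (I : {pred F}) : Prop :=
  zmod_closed I /\
  (forall a x, x \in I -> a * x \in I /\ x * a \in I).

Definition in_monomial_ideal (W : {pred {fmonom 'I_r}}) (g : F) : Prop :=
  forall I : {pred F}, two_sided_ideal I ->
    (forall w, w \in W -> (<< w >> : F) \in I) -> g \in I.

End Monomial.

(* The quotient K<x_1, ..., x_r>/(W) is given by its canonical projection pi;
   gr is the quotient grading for which every x_i has degree one. *)
Definition monomial_algebra (K : fieldType) (B : algType K)
    (gr : nat -> {pred B}) : Prop :=
  exists (r : nat) (W : {pred {fmonom 'I_r}})
         (pi : {lrmorphism {malg K[{fmonom 'I_r}]} -> B}),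
    [/\ forall x, exists g, pi g = x,
        forall g, pi g = 0 <-> in_monomial_ideal W g
      & forall n x, x \in gr n <-> exists2 g, homogeneous n g & pi g = x].

(* Main.v *)
Require Import Defs.
From HB Require Import structures.
From mathcomp Require Import all_boot all_algebra.
From mathcomp Require Import finmap.
From mathcomp.multinomials Require Import monalg.

(* Write W_0 for f(1) letters and W_(n+1) = W_n C_n, where C_n is a subset of
   W_n just large enough that |W_(n+1)| >= f(2^(n+1)); submultiplicativity says
   that W_n itself is large enough to choose C_n from.  The excess is at most
   |W_n|, so |W_n| <= 2^n f(2^n).  Let D_n be the union of W_n C_n and C_n W_n.
   A word of D_(n+1) is abcd with a, c in W_n and b, d in C_n, so its factors
   of length at most 2^n are factors of ab, bc or cd, hence of D_n.  Therefore
   the words w that are factors of D_n for n = |w| form a factor-closed set,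
   which is taken as a basis of the monomial algebra B.  It contains W_n, and
   its words of length 2^n are factors of the 2 |W_(n+1)| words of D_n, in
   2^n + 1 possible positions each. *)

Set Implicit Arguments.
Unset Strict Implicit.
Unset Printing Implicit Defensive.

Import GRing.Theory.

(** An occurrence of [w] starting inside [a] or right after it ends before [c] begins, because [w]
    is no longer than [b]; any later one avoids [a]. *)
Lemma infix_cat3 (T : eqType) (w a b c : seq T) :
  infix w (a ++ b ++ c) -> size w <= size b ->
  infix w (a ++ b) || infix w (b ++ c).
Proof.
case/infixP => p [q E] wb.
have [pa|ap] := leqP (size p) (size a).
  apply/orP; left; apply/infixP.
  exists p, (take (size (a ++ b) - size (p ++ w)) q).
  have abE : a ++ b = take (size (a ++ b)) ((p ++ w) ++ q).
    by rewrite -catA -E catA take_size_cat.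
  by rewrite {1}abE take_cat ltnNge !size_cat leq_add //= catA.
apply/orP; right; apply/infixP; exists (drop (size a) p), q.
by rewrite -(drop_size_cat (b ++ c) (erefl (size a))) E drop_cat ap.
Qed.

(** * The sets of words W_n, C_n, D_n and the factor-closed language *)

Section Words.
Variable f : nat -> nat.
Hypothesis f_submul : forall m n : nat, f (m + n) <= f m * f n.
Hypothesis f_incr : forall n : nat, f n <= f n.+1.
Local Notation r := (f 1).
Implicit Types (n : nat) (w : seq 'I_r).

(* C_n as a function of W_n: [take] caps the quotient plus one at [size s],
   which replaces the case distinction of an exact ceiling. *)
Definition extenders n (s : seq (seq 'I_r)) :=
  take (f (2 ^ n.+1) %/ size s).+1 s.

Fixpoint words n : seq (seq 'I_r) :=
  if n is n'.+1 then
    [seq u ++ v | u <- words n', v <- extenders n' (words n')]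
  else [seq [:: i] | i <- enum 'I_r].

(* The C_n and D_n of the header. *)
Definition tails n := extenders n (words n).

Definition doubles n := words n.+1 ++ [seq u ++ v | u <- tails n, v <- words n].

Lemma sub_tails n : {subset tails n <= words n}.
Proof. by move=> w; apply: mem_take. Qed.

Lemma size_word n w : w \in words n -> size w = 2 ^ n.
Proof.
elim: n w => [w /mapP[i _ ->]//|n IHn w] /allpairsP[[u v] /= [un vn ->]].
by rewrite size_cat (IHn u) // (IHn v) ?expnS ?mul2n ?addnn // sub_tails.
Qed.

Lemma uniq_words n : uniq (words n).
Proof.
elim: n => [|n IHn]; first by rewrite map_inj_uniq ?enum_uniq // => i j [].
apply: allpairs_uniq => //; first exact: take_uniq.
move=> [u v] [u' v'] /allpairsP[[? ?] /= [un _ [-> ->]]].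
move=> /allpairsP[[? ?] /= [un' _ [-> ->]]] /eqP.
rewrite eqseq_cat ?(size_word un) ?(size_word un') //.
by case/andP => /eqP-> /eqP->.
Qed.

Lemma size_wordsS n : size (words n.+1) = size (words n) * size (tails n).
Proof. exact: size_allpairs. Qed.

Lemma size_tails n :
  size (tails n) = minn (f (2 ^ n.+1) %/ size (words n)).+1 (size (words n)).
Proof. exact: size_take_min. Qed.

Lemma f_mono : {homo f : m n / m <= n}.
Proof. by apply: homo_leq => //; apply: leq_trans. Qed.

Lemma f_dbl n : f (2 ^ n.+1) <= f (2 ^ n) * f (2 ^ n).
Proof. by rewrite expnS mul2n -addnn. Qed.

Lemma words_lower n : f (2 ^ n) <= size (words n).
Proof.
elim: n => [|n IHn]; first by rewrite size_map size_enum_ord.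
rewrite size_wordsS size_tails.
have := leq_trans (f_dbl n) (leq_mul IHn IHn).
(* Either [tails n] is as large as [words n] and submultiplicativity suffices, or its size is the
   quotient plus one, which takes the product past f(2^(n+1)). *)
rewrite /minn; case: ltnP => // _; have [->//|w0] := posnP (size (words n)).
by move=> _; rewrite mulnC ltnW // ltn_ceil.
Qed.

Lemma words_upper n : size (words n) <= 2 ^ n * f (2 ^ n).
Proof.
elim: n => [|n IHn]; first by rewrite size_map size_enum_ord mul1n.
have le1 : size (words n.+1) <= f (2 ^ n.+1) + size (words n).
  rewrite size_wordsS size_tails.
  apply: (leq_trans (leq_mul (leqnn _) (geq_minl _ _))).
  by rewrite mulnS addnC leq_add2r mulnC leq_trunc_div.
apply: (leq_trans le1).
have fle : f (2 ^ n) <= f (2 ^ n.+1) by apply: f_mono; rewrite leq_exp2l.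
(* Both f(2^(n+1)) and |W_n| are at most 2^n f(2^(n+1)). *)
rewrite [X in X * _]expnS mul2n -addnn mulnDl leq_add //.
  by rewrite leq_pmull // expn_gt0.
by rewrite (leq_trans IHn) // leq_mul.
Qed.

Definition word_factor n w := (w == [::]) || has (infix w) (doubles n).

Lemma word_factor_desc n w :
  word_factor n.+1 w -> size w <= 2 ^ n -> word_factor n w.
Proof.
rewrite /word_factor; case: (w == [::]) => //= /hasP[z zd wz] wn.
have [a [b [c [d [an bn cn [dn zE]]]]]] : exists a b c d,
    [/\ a \in words n, b \in tails n, c \in words n &
        d \in tails n /\ z = a ++ b ++ c ++ d].
  (* Since C_(n+1) lies in W_(n+1) = W_n C_n, both orders in D_(n+1) split into the same pattern. *)
  move: zd; rewrite mem_cat => /orP[] /allpairsP[[x y] /= [xn yn ->]].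
    have /allpairsP[[a b] /= [an bn ->]] := xn.
    have /allpairsP[[c d] /= [cn dn ->]] := sub_tails yn.
    by exists a, b, c, d; rewrite -catA.
  have /allpairsP[[a b] /= [an bn ->]] := sub_tails xn.
  have /allpairsP[[c d] /= [cn dn ->]] := yn.
  by exists a, b, c, d; rewrite -catA.
have inW u v : u \in words n -> v \in tails n -> u ++ v \in doubles n.
  by move=> un vn; rewrite mem_cat /= allpairs_f.
have inT u v : u \in tails n -> v \in words n -> u ++ v \in doubles n.
  by move=> un vn; rewrite mem_cat orbC allpairs_f.
have wb : size w <= size b by rewrite (size_word (sub_tails bn)).
have wc : size w <= size c by rewrite (size_word cn).
rewrite {}zE in wz; have /orP[wab|] := infix_cat3 wz wb.
  by apply/hasP; exists (a ++ b) => //; apply: inW.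
move=> wbcd; have /orP[wbc|wcd] := infix_cat3 wbcd wc; apply/hasP.
  by exists (b ++ c) => //; apply: inT.
by exists (c ++ d) => //; apply: inW.
Qed.

Lemma word_factor_down m n w : n <= m ->
  word_factor m w -> size w <= 2 ^ n -> word_factor n w.
Proof.
elim: m => [|m IHm]; first by rewrite leqn0 => /eqP ->.
rewrite leq_eqVlt => /predU1P[->//|nm] wm wn.
apply: IHm => //; apply: word_factor_desc => //.
by rewrite (leq_trans wn) // leq_exp2l.
Qed.

Lemma word_factor_infix n u w : infix u w -> word_factor n w -> word_factor n u.
Proof.
rewrite /word_factor => uw /predU1P[w0|/hasP[z zn wz]].
  by move: uw; rewrite w0 infixs0 => ->.
by apply/orP; right; apply/hasP; exists z => //; apply: infix_trans wz.
Qed.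

(* Only the level [size w] is tested, which keeps the predicate decidable; it
   suffices that [size w <= 2 ^ size w] and that levels grow with length. *)
Definition in_language w := word_factor (size w) w.

Lemma in_language_infix u w : infix u w -> in_language w -> in_language u.
Proof.
move=> uw Lw; have := size_infix uw => suw.
apply: word_factor_down suw _ (ltnW (ltn_expl _ _)) => //.
exact: word_factor_infix Lw.
Qed.

(** The language tests a word of W_n at level 2^n rather than n, so the word has to be prolonged.
    This never gets stuck: C_m is nonempty as soon as W_m is. *)
Lemma words_extend n m w : n <= m -> w \in words n ->
  exists2 z, z \in words m & prefix w z.
Proof.
elim: m => [|m IHm]; first by rewrite leqn0 => /eqP -> wn;
  exists w; rewrite ?prefix_refl.
rewrite leq_eqVlt => /predU1P[<- wn|nm wn].
  by exists w; rewrite ?prefix_refl.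
have [z zm wz] := IHm nm wn.
have : 0 < size (tails m).
  by rewrite size_tails; case: (words m) zm => //= *; rewrite leq_min.
case E: (tails m) => [//|v t] _; exists (z ++ v).
  by apply: allpairs_f => //; rewrite -/(tails m) E mem_head.
exact: prefix_trans wz (prefix_prefix z v).
Qed.

Lemma words_in_language n w : w \in words n -> in_language w.
Proof.
move=> wn; rewrite /in_language (size_word wn) /word_factor.
(* The target is W_(m+1) with m = 2^n, because W_(m+1) is part of D_m. *)
have [z zm wz] := words_extend (leqW (ltnW (ltn_expl n (ltnSn 1)))) wn.
apply/orP; right; apply/hasP; exists z; last exact: prefixW.
by rewrite mem_cat zm.
Qed.

(** The candidates are windows of D_n, so that a size bound can be read off; the filter then imposes
    the test at level 2^n. *)
Definition language n : seq (seq 'I_r) :=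
  undup [seq w <- [seq take (2 ^ n) (drop i z) | z <- doubles n,
                                                 i <- iota 0 (2 ^ n).+1] |
          in_language w && (size w == 2 ^ n)].

(** The test at level 2^n descends to level n, where a word of length 2^n is a window of some word
    of D_n; the latter has length 2^(n+1), so the offset is at most 2^n. *)
Lemma mem_language n w :
  (w \in language n) = in_language w && (size w == 2 ^ n).
Proof.
rewrite mem_undup mem_filter; rewrite andb_idr // => /andP[Lw /eqP wn].
have := @word_factor_down _ n w _ Lw; rewrite wn.
move/(_ (ltnW (ltn_expl _ (ltnSn 1))) (leqnn _)).
case/predU1P => [w0|/hasP[z zd /infixP[p [q zE]]]].
  by move: wn; rewrite w0 => /esym/eqP; rewrite expn_eq0.
apply/allpairsP; exists (z, size p); split=> //.
  have : size z = 2 ^ n.+1.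
    move: zd; rewrite mem_cat => /orP[/size_word //|].
    case/allpairsP=> -[u v] /= [/sub_tails un vn ->].
    by rewrite size_cat (size_word un) (size_word vn) addnn -mul2n -expnS.
  rewrite mem_iota zE !size_cat wn expnS mul2n -addnn add0n /= ltnS.
  by rewrite addnCA => /eqP; rewrite eqn_add2l => /eqP <-; apply: leq_addr.
by rewrite zE /= drop_size_cat // -wn take_size_cat.
Qed.

Lemma language_lower n : f (2 ^ n) <= size (language n).
Proof.
apply: leq_trans (words_lower n) _.
apply: uniq_leq_size (uniq_words n) _ => w wn.
by rewrite mem_language (words_in_language wn) (size_word wn) eqxx.
Qed.

Lemma language_upper n :
  size (language n) <= 2 ^ (2 * n + 3) * f (2 ^ (n + 1)).
Proof.
apply: leq_trans (size_undup _) _; rewrite size_filter.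
apply: leq_trans (count_size _ _) _.
rewrite size_allpairs size_iota size_cat size_allpairs mulnC.
rewrite [_ * size (words n)]mulnC.
rewrite -size_wordsS addnn -mul2n addn1.
apply: leq_trans (leq_mul (leqnn _) (leq_mul (leqnn _) (words_upper n.+1))) _.
rewrite !mulnA leq_mul2r; apply/orP; right.
(* The factors bound, in turn, the 2^n + 1 offsets, the two halves of D_n, and the coefficient in
   the bound on |W_(n+1)|. *)
have -> : 2 ^ (2 * n + 3) = (2 ^ n + 2 ^ n) * 2 * 2 ^ n.+1.
  rewrite addnn -mul2n -expnS -expnSr -expnD.
  by rewrite mul2n -addnn addn3 addSn addnS addSn.
by rewrite !leq_mul // -addn1 leq_add // expn_gt0.
Qed.

End Words.

(* The complement of a factorial set is the set of monomials in a monomial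
   ideal, so [L] is the set of nonzero monomials of the quotient. *)
Record factorial_set (M : monomType) := FactorialSet {
  factorial_mem :> pred M;
  factorial_one : factorial_mem (one : M);
  factorial_mul : forall x y : M,
    factorial_mem (mmul x y) -> factorial_mem x && factorial_mem y
}.

(** * Quotient of a monoid algebra by a monomial ideal *)

Section Truncation.
Local Open Scope ring_scope.
Variables (M : monomType) (K : comNzRingType) (L : factorial_set M).
Local Notation F := {malg K[M]}.
Implicit Types g h : F.

(** Constants are central because [K] is commutative, whatever the monoid. *)
Lemma malg_scalerAr (c : K) g h : c *: (g * h) = g * (c *: h).
Proof.
rewrite -!mul_malgC !mulrA; congr (_ * h).
rewrite mul_malgC malgM_def fgmulgU [in LHS](monalgE g) scaler_sumr.
apply: eq_bigr => k _; apply/malgP => l.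
by rewrite mcoeffZ !mcoeffU mulm1 mulrC mulrnAl.
Qed.

Definition trunc g : F := [malg k in msupp g => if L k then g@_k else 0].

Lemma mcoeff_trunc g k : (trunc g)@_k = if L k then g@_k else 0.
Proof. by rewrite mcoeffE; case: msuppP => //; rewrite if_same. Qed.

Lemma trunc_is_linear : linear trunc.
Proof.
move=> c g h; apply/malgP => k.
rewrite mcoeffD mcoeffZ !mcoeff_trunc mcoeffD mcoeffZ.
by case: (L k); rewrite ?mulr0 ?addr0.
Qed.
HB.instance Definition _ := GRing.isLinear.Build K F F _ trunc trunc_is_linear.

Definition truncated : {pred F} := [pred g : F | all L (msupp g)].

Lemma truncatedP g : reflect (trunc g = g) (g \in truncated).
Proof.
apply: (iffP allP) => [Lg | gL k kg].
  apply/malgP => k; rewrite mcoeff_trunc.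
  by case: (msuppP g) => [/Lg -> //|]; rewrite if_same.
by move: kg; rewrite -mcoeff_neq0 -gL mcoeff_trunc; case: (L k); rewrite ?eqxx.
Qed.

Lemma trunc_truncated g : trunc g \in truncated.
Proof.
apply/truncatedP/malgP => k; rewrite !mcoeff_trunc.
by case: (L k).
Qed.

(** The error [trunc g - g] is supported outside [L]. So are its multiples, since a product in [L]
    has both factors in [L]. *)
Lemma truncMl g h : trunc (trunc g * h) = trunc (g * h).
Proof.
apply/eqP; rewrite -subr_eq0 -linearB /= -mulrBl; apply/eqP/malgP => k.
rewrite mcoeff_trunc mcoeff0; case: ifP => // Lk; apply/eqP.
rewrite mcoeff_eq0; apply/negP => /msuppM_le[k1 [k2 [k1g _ kE]]].
move: k1g Lk; rewrite kE => + /factorial_mul /andP[Lk1 _].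
by rewrite -mcoeff_neq0 mcoeffB mcoeff_trunc Lk1 subrr eqxx.
Qed.

Lemma truncMr g h : trunc (g * trunc h) = trunc (g * h).
Proof.
apply/eqP; rewrite -subr_eq0 -linearB /= -mulrBr; apply/eqP/malgP => k.
rewrite mcoeff_trunc mcoeff0; case: ifP => // Lk; apply/eqP.
rewrite mcoeff_eq0; apply/negP => /msuppM_le[k1 [k2 [_ k2g kE]]].
move: k2g Lk; rewrite kE => + /factorial_mul /andP[_ Lk2].
by rewrite -mcoeff_neq0 mcoeffB mcoeff_trunc Lk2 subrr eqxx.
Qed.

Lemma truncated_submod_closed : submod_closed truncated.
Proof.
split=> [|c g h /truncatedP gL /truncatedP hL]; apply/truncatedP.
  by rewrite linear0.
by rewrite trunc_is_linear gL hL.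
Qed.
HB.instance Definition _ :=
  GRing.isSubmodClosed.Build K F truncated truncated_submod_closed.

(* The quotient by the monomial ideal, realised by the normal forms. *)
Record malg_quot := MalgQuot {
  malg_quot_val :> F; _ : malg_quot_val \in truncated }.
HB.instance Definition _ := [isSub for malg_quot_val].
HB.instance Definition _ := [Choice of malg_quot by <:].
HB.instance Definition _ := [SubChoice_isSubLmodule of malg_quot by <:].

Definition malg_pi g : malg_quot := MalgQuot (trunc_truncated g).
Implicit Types x y z : malg_quot.

Lemma malg_piK x : malg_pi (val x) = x.
Proof. by apply/val_inj/truncatedP/(valP x). Qed.

Definition malg_quot_one := malg_pi 1.
Definition malg_quot_mul x y := malg_pi (val x * val y).

Lemma malg_quot_mulA : associative malg_quot_mul.
Proof.
by move=> x y z; apply/val_inj; rewrite /= truncMl truncMr mulrA.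
Qed.

Lemma malg_quot_mul1 : left_id malg_quot_one malg_quot_mul.
Proof.
move=> x; apply/val_inj; rewrite /= truncMl mul1r.
exact: (congr1 val (malg_piK x)).
Qed.

Lemma malg_quot_mulr1 : right_id malg_quot_one malg_quot_mul.
Proof.
move=> x; apply/val_inj; rewrite /= truncMr mulr1.
exact: (congr1 val (malg_piK x)).
Qed.

Lemma malg_quot_mulDl : left_distributive malg_quot_mul +%R.
Proof. by move=> x y z; apply/val_inj; rewrite /= mulrDl linearD. Qed.

Lemma malg_quot_mulDr : right_distributive malg_quot_mul +%R.
Proof. by move=> x y z; apply/val_inj; rewrite /= mulrDr linearD. Qed.

Lemma malg_quot_one_neq0 : malg_quot_one != 0.
Proof.
rewrite -val_eqE; apply/eqP => /(congr1 (mcoeff (one : M))).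
move=> /= /eqP; rewrite mcoeff_trunc factorial_one mcoeff1 eqxx mcoeff0.
by rewrite oner_eq0.
Qed.
HB.instance Definition _ := GRing.Zmodule_isNzRing.Build malg_quot
  malg_quot_mulA malg_quot_mul1 malg_quot_mulr1 malg_quot_mulDl
  malg_quot_mulDr malg_quot_one_neq0.

Lemma malg_quot_scaleAl c x y : c *: (x * y) = c *: x * y.
Proof. by apply/val_inj; rewrite /= -scalerAl linearZ. Qed.

Lemma malg_quot_scaleAr c x y : c *: (x * y) = x * (c *: y).
Proof. by apply/val_inj; rewrite /= -malg_scalerAr linearZ. Qed.
HB.instance Definition _ :=
  GRing.Lmodule_isLalgebra.Build K malg_quot malg_quot_scaleAl.
HB.instance Definition _ :=
  GRing.Lalgebra_isAlgebra.Build K malg_quot malg_quot_scaleAr.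

Lemma malg_pi_is_linear : linear malg_pi.
Proof. by move=> c g h; apply/val_inj; rewrite /= linearP. Qed.

Lemma malg_pi_is_monoid_morphism : monoid_morphism malg_pi.
Proof. by split=> // g h; apply/val_inj; rewrite /= truncMl truncMr. Qed.
HB.instance Definition _ :=
  GRing.isLinear.Build K F malg_quot _ malg_pi malg_pi_is_linear.
HB.instance Definition _ :=
  GRing.isMonoidMorphism.Build F malg_quot malg_pi malg_pi_is_monoid_morphism.

Lemma malg_piU_eq0 k : ~~ L k -> malg_pi << k >> = 0.
Proof.
move=> Lk; apply/val_inj/malgP => l; rewrite /= mcoeff_trunc mcoeff0 mcoeffU.
by case: eqP => [<-|]; rewrite ?(negPf Lk) // if_same.
Qed.

Lemma malg_pi_eq0 g : malg_pi g = 0 <-> {in msupp g, forall k, ~~ L k}.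
Proof.
split=> [/(congr1 val)/malgP g0 k | gL].
  rewrite -mcoeff_neq0; move: (g0 k); rewrite /= mcoeff_trunc mcoeff0.
  by case: (L k) => // ->; rewrite eqxx.
apply/val_inj/malgP => k; rewrite /= mcoeff_trunc mcoeff0.
by case: ifP => // Lk; apply/mcoeff_outdom/negP => /gL; rewrite Lk.
Qed.

Lemma malg_quotE x : x = \sum_(k <- msupp (val x)) (val x)@_k *: malg_pi << k >>.
Proof.
rewrite -[LHS]malg_piK {1}[val x]monalgE linear_sum; apply: eq_bigr => k _.
rewrite -linearZ; congr malg_pi; apply/malgP => l.
by rewrite mcoeffZ !mcoeffU mulrnAr mulr1.
Qed.

End Truncation.

(** * Grading, generators and bases of the quotient of the free algebra *)

Section Grading.
Local Open Scope ring_scope.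
Variables (r : nat) (K : fieldType) (L : factorial_set {fmonom 'I_r}).
Local Notation F := {malg K[{fmonom 'I_r}]}.
Local Notation B := (malg_quot K L).
Implicit Types (x y : B) (k : {fmonom 'I_r}).

Definition quot_gr (n : nat) : {pred B} :=
  [pred x : B | all (fun k => fdeg k == n) (msupp (val x))].

Lemma quot_grP n x :
  reflect (forall k, fdeg k != n -> (val x)@_k = 0) (x \in quot_gr n).
Proof.
apply: (iffP allP) => [xn k kn | xn k].
  by apply: mcoeff_outdom; apply: contra kn => /xn.
by rewrite -mcoeff_neq0; apply: contraR => /xn ->.
Qed.

Lemma mcoeff_pi (g : F) k : (val (malg_pi L g))@_k = if L k then g@_k else 0.
Proof. exact: mcoeff_trunc. Qed.

Lemma mcoeff_val_out x k : ~~ L k -> (val x)@_k = 0.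
Proof. by rewrite -[x]malg_piK mcoeff_pi => /negPf ->. Qed.

Lemma mcoeff_val_sum (J : Type) (s : seq J) (E : J -> B) k :
  (val (\sum_(j <- s) E j))@_k = \sum_(j <- s) (val (E j))@_k.
Proof. by rewrite !raddf_sum. Qed.

Lemma val_mcoeff_inj x y : (forall k, (val x)@_k = (val y)@_k) -> x = y.
Proof. by move=> xy; apply/val_inj/malgP. Qed.

Lemma quot_gr_pi n (g : F) : homogeneous n g -> malg_pi L g \in quot_gr n.
Proof.
move=> gn; apply/quot_grP => k kn; rewrite mcoeff_pi.
by case: ifP => // _; apply: mcoeff_outdom; apply: contraNN kn => /gn ->.
Qed.

Lemma quot_gr_submod n : submod_closed (quot_gr n).
Proof.
split=> [|c x y /quot_grP xn /quot_grP yn]; apply/quot_grP => k kn.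
  exact: mcoeff0.
by rewrite [val _]linearP mcoeffD mcoeffZ xn // yn // mulr0 addr0.
Qed.

Lemma homogeneousU k : homogeneous (fdeg k) (<< k >> : F).
Proof. by move=> w; rewrite msuppU1 inE => /eqP ->. Qed.

Lemma quot_gr_mul m n x y :
  x \in quot_gr m -> y \in quot_gr n -> x * y \in quot_gr (m + n)%N.
Proof.
move=> /allP xm /allP yn; apply: quot_gr_pi => k.
by case/msuppM_le => [k1 [k2 [/xm/eqP <- /yn/eqP <- ->]]]; rewrite fdegM.
Qed.

(** The support is contained in that of [x], so [malg_pi] changes no coefficient and only wraps the
    component as an element of the quotient. *)
Definition quot_comp n x : B :=
  malg_pi L [malg k in msupp (val x) => if fdeg k == n then (val x)@_k else 0].

Lemma mcoeff_quot_comp n x k :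
  (val (quot_comp n x))@_k = if fdeg k == n then (val x)@_k else 0.
Proof.
rewrite mcoeff_pi; case: ifP => [_|/negbT Lk].
  by rewrite mcoeffE; case: msuppP => //; rewrite if_same.
by rewrite (mcoeff_val_out _ Lk) if_same.
Qed.

Lemma quot_comp_gr n x : quot_comp n x \in quot_gr n.
Proof.
by apply/quot_grP => k kn; rewrite mcoeff_quot_comp (negPf kn).
Qed.

Lemma quot_graded : graded quot_gr.
Proof.
split.
- exact: quot_gr_submod.
- apply: (@quot_gr_pi 0%N 1) => k.
  by rewrite -[1]/(<< one >> : F) msuppU1 inE => /eqP ->; rewrite fdeg1.
- exact: quot_gr_mul.
(* [mmeasure] is strictly above the degree of every monomial in the support, so the sum reaches all
   nonzero components. *)
- move=> x; exists (mmeasure (@fdeg 'I_r) (val x)), (quot_comp^~ x).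
  split=> [i|]; first exact: quot_comp_gr.
  apply: val_mcoeff_inj => k; rewrite mcoeff_val_sum.
  have [kx|kx] := boolP (k \in msupp (val x)).
    rewrite (bigD1 (Ordinal (mmeasure_mnm_lt (@fdeg 'I_r) kx))) //=.
    rewrite mcoeff_quot_comp eqxx big1 ?addr0 // => i.
    rewrite mcoeff_quot_comp eq_sym -val_eqE /=.
    by case: eqP.
  rewrite big1 ?mcoeff_outdom // => i _.
  by rewrite mcoeff_quot_comp mcoeff_outdom // if_same.
- move=> n c cgr c0 i ltin; apply: val_mcoeff_inj => k; rewrite mcoeff0.
  have [ki|/(quot_grP _ _ (cgr i))//] := eqVneq (fdeg k) i.
  move/(congr1 (fun x => (val x)@_k)): c0.
  rewrite mcoeff_val_sum mcoeff0 (bigD1 (Ordinal ltin)) //= big1 ?addr0 //.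
  move=> j; rewrite -val_eqE /= => ji.
  by apply: (quot_grP _ _ (cgr j)); rewrite ki eq_sym.
Qed.

(** Serves both finite generation and generation in degree one: by linearity only images of words
    matter, and these are products of letters. *)
Lemma generates_letters (S : {pred B}) :
  (forall i, malg_pi L << fmu i >> \in S) -> generates S.
Proof.
move=> Sx A [A1 Alin AM] SA.
have A0 : 0 \in A by have := Alin (-1) 1 1 A1 A1; rewrite scaleN1r addNr.
move=> x; rewrite [x]malg_quotE.
elim/big_ind: _ => [//|y z Ay Az|k _].
  by rewrite -[y]scale1r Alin.
rewrite -[_ *: _]addr0 Alin //.
case: k; elim=> [|i s IHs].
  by rewrite -fmoneE -[<< _ >>]/(1 : F) rmorph1.
have -> : FMonom (i :: s) = mmul (fmu i) (FMonom s).
  by apply/val_inj; rewrite /= fmM fmU.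
have -> : << mmul (fmu i) (FMonom s) >> = << fmu i >> * << FMonom s >> :> F.
  by rewrite malgM_def fgmulUU mulr1.
rewrite rmorphM.
by apply: AM; [apply/SA/Sx|].
Qed.

Lemma quot_finitely_generated : finitely_generated B.
Proof.
exists [seq malg_pi L << fmu i >> | i : 'I_r].
by apply: generates_letters => i; apply: map_f; rewrite mem_enum.
Qed.

Lemma quot_generated_in_degree_one : generated_in_degree_one quot_gr.
Proof.
apply: generates_letters => i; rewrite -(fdegU i).
exact/quot_gr_pi/homogeneousU.
Qed.

Lemma quot_monomial_algebra : monomial_algebra quot_gr.
Proof.
exists r, (fun w => ~~ L w), (malg_pi L : {lrmorphism F -> B}); split.
- by move=> x; exists (val x); apply: malg_piK.
- move=> g; split=> [/malg_pi_eq0 gL I [[I0 IB] IM] IL | gI].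
    have ID : {in I &, forall a b, a + b \in I}.
      by move=> a b aI bI; rewrite -[b]opprK -[- b]add0r !IB.
    rewrite [g]monalgE big_seq; apply: (big_ind [in I]) => // k kg.
    (* An ideal absorbs products, so the coefficient is turned into a constant factor. *)
    have -> : << g@_k *g k >> = << g@_k *g one >> * << k >> :> F.
      by rewrite malgM_def fgmulUU mulr1 mul1m.
    exact: (IM << g@_k *g one >> << k >> (IL k (gL k kg))).1.
  (* Conversely, the kernel of the projection is itself an ideal containing the words outside
     [L]. *)
  apply/eqP/(gI (fun h => malg_pi L h == 0)) => [|w Lw].
    split; first split=> [|a b /eqP a0 /eqP b0].
    + by apply/eqP; rewrite rmorph0.
    + by apply/eqP; rewrite rmorphB /= a0 b0 subrr.
    move=> a b /eqP b0.
    by split; apply/eqP; rewrite rmorphM /= b0 ?mulr0 ?mul0r.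
  by apply/eqP/malg_piU_eq0.
- move=> n x; split=> [/allP xn|[g gn <-]]; last exact: quot_gr_pi.
  by exists (val x); [move=> w /xn /eqP | apply: malg_piK].
Qed.

(** The images of the words of [s] form a basis: they lie in [L], so the scalars of a combination
    are the coefficients of its normal form. *)
Lemma quot_gr_dim n (s : seq {fmonom 'I_r}) : uniq s ->
  (forall k, (k \in s) = L k && (fdeg k == n)) -> has_dim (quot_gr n) (size s).
Proof.
move=> us sP; pose e i := tnth (in_tuple s) i.
have es i : L (e i) && (fdeg (e i) == n) by rewrite -sP mem_tnth.
have e_inj : injective e by apply/tuple_uniqP.
have coefE (c : 'I_(size s) -> K) k :
    (val (\sum_i c i *: malg_pi L << e i >>))@_k = \sum_i c i * (e i == k)%:R.
  rewrite mcoeff_val_sum; apply: eq_bigr => i _.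
  rewrite -linearZ mcoeff_pi mcoeffZ mcoeffU1; case: ifP => // Lk.
  case: eqP => [eik|]; last by rewrite mulr0.
  by have /andP[] := es i; rewrite eik Lk.
have coef_e c i : \sum_j c j * (e j == e i)%:R = c i :> K.
  rewrite (bigD1 i) //= eqxx mulr1 big1 ?addr0 // => j ji.
  by rewrite (inj_eq e_inj) (negPf ji) mulr0.
exists (fun i => malg_pi L << e i >>); split=> [v|c /(congr1 val) c0 i].
  split=> [/quot_grP vn|[c ->]].
    exists (fun i => (val v)@_(e i)); apply: val_mcoeff_inj => k.
    rewrite coefE; have [/(tnthP (in_tuple s))[i ->]|] := boolP (k \in s).
      by rewrite (coef_e (fun i => (val v)@_(e i))).
    move=> ks; rewrite big1 => [|i _].
      move: ks; rewrite sP negb_and => /orP[]; [exact: mcoeff_val_out|exact: vn].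
    case: eqP => [eik|]; last by rewrite mulr0.
    by move: ks; rewrite -eik mem_tnth.
  apply/quot_grP => k kn; rewrite coefE big1 // => i _.
  case: eqP => [eik|]; last by rewrite mulr0.
  by have /andP[_] := es i; rewrite eik (negPf kn).
by rewrite -(coef_e c i) -coefE c0 mcoeff0.
Qed.

End Grading.

(** * The monomial algebra of the language *)

Section LanguageAlgebra.
Variable f : nat -> nat.
Hypothesis f_submul : forall m n : nat, f (m + n) <= f m * f n.
Hypothesis f_incr : forall n : nat, f n <= f n.+1.

Lemma in_language_mul (x y : {fmonom 'I_(f 1)}) :
  in_language (f := f) (mmul x y) ->
  in_language (f := f) x && in_language (f := f) y.
Proof.
by rewrite fmM => Lxy; apply/andP; split; apply: in_language_infix Lxy;
  [apply/prefixW/prefix_prefix | apply/suffixW/suffix_suffix].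
Qed.

Lemma in_language_one : in_language (f := f) (one : {fmonom 'I_(f 1)}).
Proof. by rewrite fm1. Qed.

Definition language_set :=
  FactorialSet (factorial_mem := fun w => in_language (f := f) (fmonom_val w))
    in_language_one in_language_mul.

Lemma language_dim (K : fieldType) n :
  has_dim (@quot_gr _ K language_set (2 ^ n)) (size (language f n)).
Proof.
rewrite -(size_map (@FMonom 'I_(f 1))); apply: quot_gr_dim => [|[w]].
  by rewrite map_inj_uniq ?undup_uniq // => u v [].
by rewrite mem_map ?mem_language // => u v [].
Qed.

End LanguageAlgebra.

Theorem theorem3 (K : closedFieldType) (f : nat -> nat)
    (f_submul : forall m n : nat, f (m + n) <= f m * f n)
    (f_incr : forall n : nat, f n <= f n.+1) :
  exists (B : algType K) (gr : nat -> {pred B}),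
    [/\ graded gr,
        finitely_generated B,
        generated_in_degree_one gr,
        forall n : nat, exists2 d : nat,
          has_dim (gr (2 ^ n)) d &
          f (2 ^ n) <= d <= 2 ^ (2 * n + 3) * f (2 ^ (n + 1))
      & monomial_algebra gr].
Proof.
exists (malg_quot K (language_set f)), (@quot_gr _ K (language_set f)).
split.
- exact: quot_graded.
- exact: quot_finitely_generated.
- exact: quot_generated_in_degree_one.
- move=> n; exists (size (language f n)); first exact: language_dim.
  by rewrite language_lower // language_upper.
- exact: quot_monomial_algebra.
Qed.
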